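(* Let $n\ge 3$ be an integer. Then the bipartite Kneser graph $H(n,1)$ is a Cayley graph; that is, there exist a finite group $G$ and a subset $\Omega\subseteq G$, closed under taking inverses and not containing the identity, such that $H(n,1)\cong \mathrm{Cay}(G,\Omega)$.
   Context: Let $[n]=\{1,2,\dots,n\}$. For $n\ge 3$, the bipartite Kneser graph $H(n,1)$ is the simple graph whose vertices are all the $1$-element subsets and all the $(n-1)$-element subsets of $[n]$, two distinct vertices $A,B$ being adjacent if and only if $A\subset B$ or $B\subset A$. For a finite group $G$ and a subset $\Omega\subseteq G$ closed under taking inverses and not containing the identity, the Cayley graph $\mathrm{Cay}(G,\Omega)$ has vertex set $G$ and edge set $\{\{x,y\} : x^{-1}y\in\Omega\}$. *)

(* Defs.v *)
From mathcomp Require Import all_boot all_fingroup.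

Set Implicit Arguments.
Unset Strict Implicit.
Unset Printing Implicit Defensive.

Record sgraph := SGraph {
  vertex : finType;
  adj : rel vertex;
  adj_sym : symmetric adj;
  adj_irrefl : irreflexive adj
}.

Definition graph_iso (G H : sgraph) : Prop :=
  exists2 f : vertex G -> vertex H,
    bijective f & {mono f : x y / adj x y >-> adj x y}.

Section BipartiteKneser.

Variable n : nat.

(* The ground set [n] = {1, ..., n} is represented by 'I_n = {0, ..., n-1}. *)
Definition bk_vertex : finType :=
  {A : {set 'I_n} | (#|A| == 1) || (#|A| == n - 1)}.

Definition bk_adj : rel bk_vertex := fun A B =>
  (A != B) && ((val A \subset val B) || (val B \subset val A)).

Lemma bk_adj_sym : symmetric bk_adj.
Proof. by move=> A B; rewrite /bk_adj eq_sym orbC. Qed.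

Lemma bk_adj_irrefl : irreflexive bk_adj.
Proof. by move=> A; rewrite /bk_adj eqxx. Qed.

Definition bipartite_kneser1 : sgraph := SGraph bk_adj_sym bk_adj_irrefl.

End BipartiteKneser.

Section Cayley.

Local Open Scope group_scope.

Variables (gT : finGroupType) (Omega : {set gT}).
Hypothesis OmegaV : forall x, x \in Omega -> x^-1 \in Omega.
Hypothesis Omega1 : 1 \notin Omega.

Definition cayley_adj : rel gT := fun x y => x^-1 * y \in Omega.

Lemma cayley_adj_sym : symmetric cayley_adj.
Proof.
move=> x y; rewrite /cayley_adj.
by apply/idP/idP => /OmegaV; rewrite invMg invgK.
Qed.

Lemma cayley_adj_irrefl : irreflexive cayley_adj.
Proof. by move=> x; rewrite /cayley_adj mulVg; apply/negbTE. Qed.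

Definition cayley_graph : sgraph := SGraph cayley_adj_sym cayley_adj_irrefl.

End Cayley.

(* Main.v *)
Require Import Defs.
From mathcomp Require Import all_boot all_fingroup.
From mathcomp Require Import zmodp.

(** For [n >= 3] every vertex of [H(n,1)] is either a singleton [{i}] or the
    complement of one, and never both, so it carries two coordinates: the point
    [i] and a bit telling which of the two kinds it is.  Two singletons, or two
    co-singletons, are comparable only when equal, while [{i}] is contained in
    the complement of [{j}] exactly when [i <> j].  Hence two vertices are
    adjacent iff they differ in both coordinates ([kneser_set_adj]): [H(n,1)]
    is the tensor product of the complete graphs [K_n] and [K_2].

    Each of these complete graphs is the Cayley graph of a group for the set of
    its nontrivial elements, and a tensor product of Cayley graphs is a Cayley
    graph of the product group.  So [Z_n * Z_2] works, with the connection set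
    of all pairs whose two components are both nontrivial. *)

Lemma inj_surj_bij (T U : finType) (g : T -> U) :
  injective g -> (forall y, exists x, g x = y) -> bijective g.
Proof.
move=> g_inj g_surj.
have surjb y : exists x, g x == y by have [x <-] := g_surj y; exists x.
have fK y : g (xchoose (surjb y)) = y by apply/eqP/(xchooseP (surjb y)).
by exists (fun y => xchoose (surjb y)) => // x; apply: g_inj.
Qed.

Lemma graph_iso_sym (G H : sgraph) : graph_iso G H -> graph_iso H G.
Proof.
case=> f [g fK gK] f_mono; exists g; first by exists f.
by move=> x y; rewrite -f_mono !gK.
Qed.

Section BothNontrivial.

Local Open Scope group_scope.

Variables gT hT : finGroupType.

Definition both_nontrivial : {set gT * hT} :=
  [set x | (x.1 != 1) && (x.2 != 1)].

Lemma both_nontrivialV x : x \in both_nontrivial -> x^-1 \in both_nontrivial.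
Proof. by rewrite !inE /= !invg_eq1. Qed.

Lemma both_nontrivial1 : 1 \notin both_nontrivial.
Proof. by rewrite inE /= eqxx. Qed.

Lemma both_nontrivial_adj x y :
  (x^-1 * y \in both_nontrivial) = (x.1 != y.1) && (x.2 != y.2).
Proof. by rewrite inE /= -!eq_invg_mul !invgK. Qed.

End BothNontrivial.

Section KneserCoordinates.

Variable m : nat.
Hypothesis m_gt1 : 1 < m.

Implicit Types (i j : 'I_m.+1) (x y : 'I_m.+1 * 'I_2).

Definition kneser_set x : {set 'I_m.+1} :=
  if x.2 == ord0 then [set x.1] else ~: [set x.1].

Lemma card_kneser_set x :
  (#|kneser_set x| == 1) || (#|kneser_set x| == m.+1 - 1).
Proof.
rewrite /kneser_set; case: ifP => _; first by rewrite cards1.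
by rewrite cardsC1 card_ord subn1 eqxx orbT.
Qed.

Definition kneser_vertex x : bk_vertex m.+1 :=
  Sub (kneser_set x) (card_kneser_set x).

(** This is where at least three points are required: a co-singleton then has
    at least two elements. *)
Lemma setC1_not_sub1 i j : ~: [set i] \subset [set j] = false.
Proof.
apply/negbTE/negP => /subset_leq_card.
by rewrite cardsC1 cards1 card_ord /= leqNgt m_gt1.
Qed.

Lemma set1_neq_setC1 i j : ([set i] == ~: [set j]) = false.
Proof. by apply/eqP => eq_ij; have := setC1_not_sub1 j i; rewrite eq_ij subxx. Qed.

Lemma ord2_eq (a b : 'I_2) : (a == b) = ((a == ord0) == (b == ord0)).
Proof. by case: a b => [[|[|//]] ?] [[|[|//]] ?]. Qed.

Lemma kneser_set_inj : injective kneser_set.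
Proof.
move=> [i a] [j b]; rewrite /kneser_set /= => eq_xy.
have [eq_ab eq_ij]: a == b /\ i = j.
  rewrite ord2_eq; move: eq_xy; do 2!case: ifP => _.
  - by move=> /set1_inj.
  - by move/eqP; rewrite set1_neq_setC1.
  - by move/esym/eqP; rewrite set1_neq_setC1.
  - by move=> /setC_inj/set1_inj.
by rewrite eq_ij (eqP eq_ab).
Qed.

Lemma kneser_vertex_surj (A : bk_vertex m.+1) : exists x, kneser_vertex x = A.
Proof.
case: A => A cardA.
suff [x defA]: exists x, kneser_set x = A by exists x; apply: val_inj.
case/orP: cardA => [/cards1P [i ->] | cardA]; first by exists (i, ord0).
have /cards1P [i defCA]: #|~: A| == 1.
  rewrite -(eqn_add2l #|A|) cardsC card_ord (eqP cardA).
  by rewrite subn1 addn1.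
by exists (i, ord_max); rewrite /kneser_set /= -defCA setCK.
Qed.

Lemma kneser_vertex_bij : bijective kneser_vertex.
Proof.
apply: inj_surj_bij kneser_vertex_surj => x y /(congr1 val).
exact: kneser_set_inj.
Qed.

Lemma kneser_set_adj x y :
  (kneser_set x != kneser_set y) &&
    ((kneser_set x \subset kneser_set y) || (kneser_set y \subset kneser_set x))
  = (x.1 != y.1) && (x.2 != y.2).
Proof.
case: x y => [i a] [j b]; rewrite ord2_eq /kneser_set /=.
do 2!case: ifP => _; rewrite /= ?andbF ?andbT.
- rewrite !sub1set !inE [j == i]eq_sym orbb.
  by case: (i =P j) => [->|]; rewrite ?eqxx ?andbF.
- by rewrite set1_neq_setC1 setC1_not_sub1 sub1set !inE orbF.
- by rewrite eq_sym set1_neq_setC1 setC1_not_sub1 sub1set !inE eq_sym.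
- rewrite !setCS !sub1set !inE [j == i]eq_sym orbb.
  by case: (i =P j) => [->|]; rewrite ?eqxx ?andbF.
Qed.

End KneserCoordinates.

Theorem proposition3p5 (n : nat) (hn : 3 <= n) :
  exists (gT : finGroupType) (Omega : {set gT})
         (OmegaV : forall x : gT, x \in Omega -> (x^-1)%g \in Omega)
         (Omega1 : (1%g : gT) \notin Omega),
    graph_iso (bipartite_kneser1 n) (cayley_graph OmegaV Omega1).
Proof.
case: n hn => // m m_gt1.
exists ('I_m.+1 * 'I_2)%type, (both_nontrivial 'I_m.+1 'I_2).
exists (both_nontrivialV _ _), (both_nontrivial1 _ _).
apply: graph_iso_sym; exists (kneser_vertex m); first exact: kneser_vertex_bij.
move=> x y; rewrite /= /cayley_adj both_nontrivial_adj.
exact: kneser_set_adj.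
Qed.
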